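(* Let $k\ge 1$ and let $P$ be the fan poset $\mathcal V(\ell_1,\ldots,\ell_k)$, with $\ell_1\ge\cdots\ge\ell_k\ge 2$. Then: (i) If $k=1$ or if $\ell_1-1>\ell_2>\cdots>\ell_k$, then $P$ is uniformly L-bounded. (ii) If $\ell_1>\ell_2>\cdots>\ell_k$, then $P$ is centrally L-bounded. (iii) If $\ell_1>\ell_2$, then $P$ is L-bounded. (iv) If $\ell_1=\ell_2$, then $P$ is not L-bounded, but it is lower-L-bounded. (Conditions mentioning $\ell_2$ in (iii) and (iv) presuppose $k\ge2$.)
   Context: All posets are finite and nonempty. Let $[n]=\{1,\dots,n\}$; families of subsets of $[n]$ are ordered by inclusion. A poset $(P,\le)$ contains a poset $(P',\le')$ as a (weak) subposet if there is an injection $f:P'\to P$ such that $u\le' v$ implies $f(u)\le f(v)$. A family $\mathcal F\subseteq 2^{[n]}$ is $P$-free if it does not contain $P$ in this sense. $e(P)$ is the maximum integer $k\ge 0$ such that for all integers $n$ and $s$ the family $\binom{[n]}{s}\cup\binom{[n]}{s+1}\cup\cdots\cup\binom{[n]}{s+k-1}$ is $P$-free, where $\binom{[n]}{j}$ is the collection of $j$-element subsets of $[n]$ (empty if $j<0$ or $j>n$). The Lubell function of $\mathcal F\subseteq 2^{[n]}$ is the average over all $n!$ full (maximal) chains $\mathcal C$ of $2^{[n]}$ of $|\mathcal F\cap\mathcal C|$; equivalently $\bar h_n(\mathcal F)=\sum_{F\in\mathcal F}1/\binom{n}{|F|}$. For an integer $m\ge0$, $P$ is $m$-L-bounded if for all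 $n$, $\bar h_n(\mathcal F)\le e(P)$ for every $P$-free family $\mathcal F$ of subsets of $[n]$ all of whose members have sizes in $[m,n-m]$. $P$ is uniformly L-bounded if it is $0$-L-bounded, centrally L-bounded if it is $1$-L-bounded, and L-bounded if it is $m$-L-bounded for some integer $m\ge 0$. $P$ is lower-L-bounded if for any $\beta\in(\frac12,1)$ and $\varepsilon>0$ there exists $N=N(\beta,\varepsilon)$ such that for all $n\ge N$, $\bar h_n(\mathcal F)\le e(P)+\varepsilon$ for all $P$-free families $\mathcal F$ of subsets of $[n]$ of sizes less than $\beta n$. Let $\mathcal P_\ell$ denote the chain with $\ell$ elements. For $\ell_1\ge\cdots\ge\ell_k\ge2$, the fan $\mathcal V(\ell_1,\ldots,\ell_k)$ is the poset obtained from disjoint chains $\mathcal P_{\ell_1},\ldots,\mathcal P_{\ell_k}$ by identifying their minimum elements (elements of different chains other than the common minimum are incomparable). *)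

(* Defs.v *)
From HB Require Import structures.
From mathcomp Require Import boolp classical_sets reals.
From mathcomp Require Import all_boot all_order all_algebra.

Set Implicit Arguments.
Unset Strict Implicit.
Unset Printing Implicit Defensive.

Import Order.TTheory GRing.Theory Num.Theory.

(* The ground set [n] is 'I_n, and a family of subsets of [n] is a            *)
(* {set {set 'I_n}}.                                                          *)

Section PosetFree.
Context {d : Order.disp_t} (P : finPOrderType d).

Definition contains n (F : {set {set 'I_n}}) : Prop :=
  exists f : P -> {set 'I_n},
    [/\ injective f, forall x, f x \in F &
        forall x y, (x <= y)%O -> f x \subset f y].

Definition poset_free n (F : {set {set 'I_n}}) : Prop := ~ contains F.

End PosetFree.

Definition level n (j : int) : {set {set 'I_n}} :=
  [set A : {set 'I_n} | Posz #|A| == j].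

Definition levels n (s : int) (k : nat) : {set {set 'I_n}} :=
  \bigcup_(i < k) level n (s + Posz i)%R.

Definition levels_free {d : Order.disp_t} (P : finPOrderType d) (k : nat) :=
  forall (n : nat) (s : int), poset_free P (levels n s k).

(* The maximum exists as soon as P is nonempty, see poset_eP below.           *)
Definition poset_e {d : Order.disp_t} (P : finPOrderType d) : nat :=
  xget 0 [set k : nat | levels_free P k /\
                        forall j, levels_free P j -> j <= k]%classic.

Lemma poset_eP {d : Order.disp_t} (P : finPOrderType d) : 0 < #|P| ->
  levels_free P (poset_e P) /\
  forall j, levels_free P j -> j <= poset_e P.
Proof.
move=> P0; rewrite /poset_e.
have free0 : `[< levels_free P 0 >].
  apply/asboolP => n s [f [_ fF _]]; case/card_gt0P: P0 => x _.
  by move: (fF x); rewrite /levels big_ord0 inE.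
have bnd k : `[< levels_free P k >] -> k <= #|P|.
  move=> /asboolP Pk; rewrite leqNgt; apply/negP => ltk.
  apply: (Pk #|P| 0%R).
  exists (fun x => [set i | (enum_val i <= x)%O]); split.
  - move=> x y /setP exy; apply/le_anti/andP; split.
      by have := exy (enum_rank x); rewrite !inE enum_rankK lexx => <-.
    by have := exy (enum_rank y); rewrite !inE enum_rankK lexx => ->.
  - move=> x; set A := [set _ | _].
    have ltA : #|A| < k.
      by apply: leq_ltn_trans ltk; rewrite -[leqRHS]card_ord max_card.
    by apply/bigcupP; exists (Ordinal ltA); rewrite ?inE ?add0r.
  - move=> x y lexy; apply/subsetP => i; rewrite !inE => /le_trans; exact.
have exP : exists k, `[< levels_free P k >] by exists 0.
case: (ex_maxnP exP bnd) => m /asboolP Pm mmax.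
have maxm j : levels_free P j -> j <= m by move=> /asboolP; exact: mmax.
by case: xgetP => [y _ //|/(_ m)[]].
Qed.

Definition is_chain n (C : {set {set 'I_n}}) : bool :=
  [forall A in C, forall B in C, (A \subset B) || (B \subset A)].

Definition full_chains n : {set {set {set 'I_n}}} :=
  [set C | maxset (@is_chain n) C].

Section FullChains.
Variable n : nat.
Implicit Types (A B : {set 'I_n}) (C : {set {set 'I_n}}).

Lemma is_chainP C :
  reflect {in C &, forall A B, (A \subset B) || (B \subset A)} (is_chain C).
Proof.
apply: (iffP forall_inP) => [cC A B AC BC|cC A AC].
  by have /forall_inP/(_ B BC) := cC A AC.
by apply/forall_inP => B BC; exact: cC.
Qed.

Lemma chain_card_inj C : is_chain C -> {in C &, injective (fun A => #|A|)}.
Proof.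
move=> /is_chainP cC A B AC BC /= eAB; have /orP[sAB|sBA] := cC A B AC BC.
  by apply/eqP; rewrite eqEcard sAB eAB leqnn.
by apply/eqP; rewrite eq_sym eqEcard sBA eAB leqnn.
Qed.

Let card_ltn A : #|A| < n.+1.
Proof. by rewrite ltnS -[leqRHS]card_ord max_card. Qed.

Let size_ord A : 'I_n.+1 := Ordinal (card_ltn A).

Lemma card_chain_image C : is_chain C -> #|size_ord @: C| = #|C|.
Proof.
move=> cC; apply: card_in_imset => A B AC BC /(congr1 val) /=.
exact: chain_card_inj cC A B AC BC.
Qed.

Lemma card_chain C : is_chain C -> #|C| <= n.+1.
Proof. by move=> /card_chain_image <-; rewrite -[leqRHS]card_ord max_card. Qed.

Lemma subset_between A B k : A \subset B -> #|A| <= k <= #|B| ->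
  exists D : {set 'I_n}, [/\ A \subset D, D \subset B & #|D| = k].
Proof.
move=> sAB; elim: k => [/andP[]|k IH /andP[]].
  by rewrite leqn0 => /eqP A0 _; exists A.
rewrite leq_eqVlt => /orP[/eqP eA _|]; first by exists A.
rewrite ltnS => Ak kB; have [|D [AD DB eD]] := IH; first by rewrite Ak ltnW.
have /set0Pn[x /setDP[xB xD]] : B :\: D != set0.
  rewrite setD_eq0; apply/negP => /subset_leq_card; rewrite eD.
  by rewrite leqNgt kB.
exists (x |: D); split; last by rewrite cardsU1 xD eD.
  by rewrite (subset_trans AD) // subsetUr.
by rewrite subUset DB sub1set xB.
Qed.

Lemma full_chain_level C k : C \in full_chains n -> k <= n ->
  exists2 A, A \in C & #|A| = k.
Proof.
rewrite inE => /maxsetP[/is_chainP cC mC] kn.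
have extremal (Q : pred {set 'I_n}) A0 : Q A0 -> A0 \in C ->
  (exists A1, [/\ A1 \in C, Q A1 & forall A, A \in C -> Q A -> A \subset A1]) /\
  (exists A1, [/\ A1 \in C, Q A1 & forall A, A \in C -> Q A -> A1 \subset A]).
  move=> QA0 CA0; have q0 : (A0 \in C) && Q A0 by rewrite CA0.
  split.
    case: (@arg_maxnP _ A0 (fun A => (A \in C) && Q A) (fun A => #|A|) q0).
    move=> A1 /andP[CA1 QA1] m; exists A1; split=> // A CA QA.
    have /orP[//|s] := cC _ _ CA CA1.
    by have /eqP<- : A1 == A by rewrite eqEcard s; apply: m; rewrite CA.
  case: (@arg_minnP _ A0 (fun A => (A \in C) && Q A) (fun A => #|A|) q0).
  move=> A1 /andP[CA1 QA1] m; exists A1; split=> // A CA QA.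
  have /orP[//|s] := cC _ _ CA1 CA.
  by have /eqP<- : A == A1 by rewrite eqEcard s; apply: m; rewrite CA.
have addC (D : {set 'I_n}) : (forall A, A \in C -> (A \subset D) || (D \subset A)) ->
  D \in C.
  move=> cD; rewrite -(mC (D |: C)) ?setU11 ?subsetUr //; apply/is_chainP => A B.
  rewrite !inE => /orP[/eqP->|CA] /orP[/eqP->|CB]; rewrite ?subxx //.
  - by rewrite orbC cD.
  - exact: cD.
  - exact: cC.
have C0 : set0 \in C by apply: addC => A _; rewrite sub0set orbT.
have CT : setT \in C by apply: addC => A _; rewrite subsetT.
have set0k : #|@set0 'I_n| <= k by rewrite cards0.
have [[A [CA Ak mA]] _] := extremal (fun A => #|A| <= k) set0 set0k C0.
have Tk : k <= #|[set: 'I_n]| by rewrite cardsT card_ord.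
have [_ [B [CB Bk mB]]] := extremal (fun A => k <= #|A|) setT Tk CT.
have sAB : A \subset B.
  have /orP[//|sBA] := cC _ _ CA CB.
  have /eqP-> : B == A by rewrite eqEcard sBA (leq_trans Ak).
  exact: subxx.
have [|D [AD DB eD]] := @subset_between A B k sAB; first by rewrite Ak Bk.
exists D => //; apply: addC => E CE; have [Ek|/ltnW Ek] := leqP #|E| k.
  by rewrite (subset_trans (mA _ CE Ek)).
by rewrite (subset_trans DB (mB _ CE Ek)) orbT.
Qed.

Lemma full_chainE C : (C \in full_chains n) = is_chain C && (#|C| == n.+1).
Proof.
apply/idP/andP => [fC|[cC /eqP eC]].
  have cC : is_chain C by move: fC; rewrite inE => /maxsetP[].
  split=> //; rewrite -card_chain_image //.
  suff -> : size_ord @: C = setT by rewrite cardsT card_ord.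
  apply/setP => k; rewrite inE.
  have [|A CA eA] := @full_chain_level C k fC; first by rewrite -ltnS.
  by apply/imsetP; exists A => //; exact/val_inj.
rewrite inE; apply/maxsetP; split=> // D cD sCD.
by apply/eqP; rewrite eq_sym eqEcard sCD eC card_chain.
Qed.

Let through A := [set C in full_chains n | A \in C].

Let throughE A C :
  (C \in through A) = (C \in full_chains n) && (A \in C).
Proof. by rewrite in_set. Qed.

Let card_through_sum A :
  \sum_(C in full_chains n) (A \in C : nat) = #|through A|.
Proof.
rewrite -sum1_card big_mkcond [RHS]big_mkcond /=; apply: eq_bigr => C _.
by rewrite throughE; case: (C \in _); case: (A \in C).
Qed.

Lemma leq_through A B : #|A| = #|B| -> #|through A| <= #|through B|.
Proof.
move=> eAB.
pose s (D : {set 'I_n}) := enum D ++ enum (~: D).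
have s_uniq (D : {set 'I_n}) : uniq (s D).
  rewrite cat_uniq !enum_uniq andbT; apply/hasPn => x.
  by rewrite !mem_enum inE.
have s_mem (D : {set 'I_n}) x : x \in s D by rewrite mem_cat !mem_enum inE orbN.
have s_size (D : {set 'I_n}) : size (s D) = n by rewrite size_cat -!cardE cardsC card_ord.
pose g x := nth x (s B) (index x (s A)).
have gi : injective g.
  have ltg x : index x (s A) < size (s B).
    by rewrite s_size -[leqRHS](s_size A) index_mem.
  move=> x y; rewrite /g (set_nth_default y x (ltg x)) => /eqP.
  by rewrite nth_uniq // => /eqP /index_inj; apply.
have gA : g @: A = B.
  apply/eqP; rewrite eqEcard card_imset // eAB leqnn andbT.
  apply/subsetP => _ /imsetP[x xA ->]; rewrite /g /s.
  have ix : index x (enum A) < #|A| by rewrite cardE index_mem mem_enum.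
  rewrite index_cat mem_enum xA nth_cat -cardE -eAB ix -mem_enum mem_nth //.
  by rewrite -cardE -eAB.
pose h (C : {set {set 'I_n}}) := [set g @: D | D : {set 'I_n} in C].
have hi : injective h by apply: imset_inj; exact: imset_inj.
rewrite -(card_imset _ hi); apply/subset_leq_card/subsetP => _ /imsetP[C + ->].
rewrite !throughE !full_chainE => /andP[/andP[/is_chainP cC eC] AC].
rewrite card_imset ?eC; last exact: imset_inj.
rewrite -gA imset_f // !andbT; apply/is_chainP.
move=> _ _ /imsetP[D DC ->] /imsetP[E EC ->].
by have /orP[/(imsetS g)->|/(imsetS g)->] := cC D E DC EC; rewrite ?orbT.
Qed.

Lemma card_through A : #|through A| * 'C(n, #|A|) = #|full_chains n|.
Proof.
transitivity (\sum_(B : {set 'I_n} | #|B| == #|A|)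
                \sum_(C in full_chains n) (B \in C : nat)).
  rewrite (eq_bigr (fun=> #|through A|)) => [|B /eqP eB].
    rewrite sum_nat_const mulnC; congr (_ * _).
    have := card_draws 'I_n #|A|; rewrite card_ord => <-.
    by rewrite cardsE.
  have -> : #|through A| = #|through B|.
    by apply/eqP; rewrite eqn_leq !leq_through.
  exact: card_through_sum.
rewrite exchange_big /= -[RHS]sum1_card; apply: eq_bigr => C fC.
have [|B BC eB] := @full_chain_level C #|A| fC.
  by rewrite -[leqRHS]card_ord max_card.
rewrite (bigD1 B) ?eB //= BC big1 // => D /andP[/eqP eD DB].
case DC: (D \in C) => //; case/eqP: DB.
have cC : is_chain C by move: fC; rewrite full_chainE => /andP[].
by apply: (chain_card_inj cC) => //=; rewrite eD.
Qed.

Lemma card_full_chains_gt0 : 0 < #|full_chains n|.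
Proof.
have [|C mC _] := @maxset_exists _ (@is_chain n) finset.set0.
  by apply/is_chainP => A B; rewrite inE.
by apply/card_gt0P; exists C; rewrite inE.
Qed.

Lemma sum_full_chains (F : {set {set 'I_n}}) :
  \sum_(C in full_chains n) #|F :&: C| = \sum_(A in F) #|through A|.
Proof.
transitivity (\sum_(C in full_chains n) \sum_(A in F) (A \in C : nat)).
  apply: eq_bigr => C _; rewrite -sum1_card big_mkcond [RHS]big_mkcond /=.
  by apply: eq_bigr => A _; rewrite inE; case: (A \in F); case: (A \in C).
rewrite exchange_big /=; apply: eq_bigr => A _.
by rewrite card_through_sum.
Qed.

End FullChains.

Section Boundedness.
Variable R : realType.
Local Open Scope ring_scope.

Definition lubell n (F : {set {set 'I_n}}) : R :=
  (\sum_(C in full_chains n) #|F :&: C|%:R) / #|full_chains n|%:R.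

Lemma lubellE n (F : {set {set 'I_n}}) :
  lubell F = \sum_(A in F) ('C(n, #|A|)%:R)^-1.
Proof.
rewrite /lubell -natr_sum sum_full_chains natr_sum mulr_suml.
apply: eq_bigr => A _.
have bin0 : ('C(n, #|A|)%:R : R) != 0.
  by rewrite pnatr_eq0 -lt0n bin_gt0 -[leqRHS]card_ord max_card.
have chains0 : (#|full_chains n|%:R : R) != 0.
  by rewrite pnatr_eq0 -lt0n card_full_chains_gt0.
by apply/(mulIf bin0); rewrite mulVf // mulrAC -natrM card_through divff.
Qed.

Context {d : Order.disp_t} (P : finPOrderType d).

Definition mL_bounded (m : nat) : Prop :=
  forall (n : nat) (F : {set {set 'I_n}}), poset_free P F ->
    (forall A, A \in F -> (m <= #|A| <= n - m)%N) ->
    lubell F <= (poset_e P)%:R.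

Definition uniformly_L_bounded : Prop := mL_bounded 0.

Definition centrally_L_bounded : Prop := mL_bounded 1.

Definition L_bounded : Prop := exists m : nat, mL_bounded m.

Definition lower_L_bounded : Prop :=
  forall beta eps : R, 2^-1 < beta < 1 -> 0 < eps ->
  exists N : nat, forall n : nat, (N <= n)%N ->
  forall F : {set {set 'I_n}}, poset_free P F ->
    (forall A, A \in F -> #|A|%:R < beta * n%:R) ->
    lubell F <= (poset_e P)%:R + eps.

End Boundedness.

(* The fan V(l_1, ..., l_k) for l = [:: l_1; ...; l_k]: None is the common    *)
(* minimum, and Some (Tagged _ j) in component i is the element of rank j + 1 *)
(* of the i-th chain, which has l_i - 1 elements besides its minimum.         *)
Definition fan (l : seq nat) : Type :=
  option {i : 'I_(size l) & 'I_(nth 0 l i).-1}.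

HB.instance Definition _ l := Finite.on (fan l).

Section FanOrder.
Variable l : seq nat.
Implicit Types x y z : fan l.

Definition fan_le x y : bool :=
  match x, y with
  | None, _ => true
  | Some _, None => false
  | Some u, Some v => (tag u == tag v) && (tagged u <= tagged v)
  end.

Fact fan_le_refl : reflexive fan_le.
Proof. by case=> //= u; rewrite eqxx leqnn. Qed.

Fact fan_le_anti : antisymmetric fan_le.
Proof.
move=> [[i a]|] [[j b]|] //= /andP[/andP[/eqP eij ab] /andP[_ ba]].
subst j; congr (Some (existT _ i _)).
by apply/val_inj/eqP; rewrite eqn_leq ab.
Qed.

Fact fan_le_trans : transitive fan_le.
Proof.
move=> [v|] [u|] [w|] //= /andP[/eqP tuv uv] /andP[/eqP tvw vw].
by apply/andP; split; [rewrite tuv tvw | exact: leq_trans uv vw].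
Qed.

Fact fan_display : Order.disp_t. Proof. exact: Order.Disp tt tt. Qed.

HB.instance Definition _ := Order.Le_isPOrder.Build fan_display (fan l)
  fan_le_refl fan_le_anti fan_le_trans.

End FanOrder.

(* Main.v *)
(* Here e(P) = l_1 - 1.  Sort the full chains meeting F by the least         *)
(* member A of F they contain; it is enough to bound the average of |F :&: C| *)
(* over each block.  Swapping two elements outside A preserves the block of   *)
(* A, so a member B of F with A < B < [n] lies on at most a 1 / (n - |A|)     *)
(* fraction of its chains.  If the average of the members above A exceeds     *)
(* a - 1, some full chain contains a of them; deleting these changes the      *)
(* average by at most a / (n - |A|) < 1 (leaving [n] aside), so chains of     *)
(* l_1 - 1, l_2 - 1, ... members can be removed greedily and form, with A,    *)
(* a fan.  When l_1 = l_2, take l_1 consecutive levels but replace the second *)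
(* one by a single set G0: every chain with l_1 members passes through G0, so *)
(* the family is P-free, while its Lubell function exceeds l_1 - 1.           *)
Require Import Defs.
From mathcomp Require Import all_boot all_order all_algebra all_fingroup.
From mathcomp Require Import reals.
From mathcomp Require Import lra zify.

Set Implicit Arguments.
Unset Strict Implicit.
Unset Printing Implicit Defensive.

Import Order.TTheory GRing.Theory Num.Theory.

(** Let w be the number of full chains in the block of A, those whose least member of F is A. By
    [lubell_le_min_block] it suffices that these chains meet F at most c * w times in total. A
    itself accounts for w, so otherwise the sets above A have mass more than (c - 1) * w, and
    [greedy_chains] draws disjoint branches there: counting from 0, branch i is available once (l_i
    - 2) * w plus the cost of the i earlier removals is below that mass ([free_mass_le]).

    By [poset_e_fan] the target is c = l_0 - 1, up to epsilon for lower-L-boundedness; the cases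
    differ in the cost of a removal. By [card_block_through], a set other than [n] above A costs at
    most w / (n - |A|). A whole chain avoiding [n] thus costs at most w, which strict decrease of l
    absorbs ([strict_mass_le]); [n] can cost w by itself, but it may end the longest branch
    ([strict_top_mass_le]). When n - |A| is large a removal costs a small fraction of w, absorbed by
    l_1 < l_0 or by epsilon ([wide_lubell_le]). For l_0 = l_1 the family [G0 |: gap_levels] forces
    two longest branches to share G0. *)

(** * Blocks of full chains by least member *)

Definition min_block n (F : {set {set 'I_n}}) (A : {set 'I_n}) :=
  [set C in full_chains n | (A \in F :&: C) && [forall B in F :&: C, A \subset B]].

Lemma min_blockP n (F : {set {set 'I_n}}) A C :
  reflect [/\ C \in full_chains n, A \in F, A \in C &
              forall B, B \in F -> B \in C -> A \subset B]
          (C \in min_block F A).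
Proof.
apply: (iffP setIdP) => [[fC /andP[/setIP[AF AC] /forall_inP mA]]|].
  by split=> // B BF BC; apply: mA; rewrite inE BF.
case=> fC AF AC mA; split=> //; apply/andP; split; first exact/setIP.
by apply/forall_inP => B /setIP[]; exact: mA.
Qed.

Lemma full_chain_is_chain n (C : {set {set 'I_n}}) : C \in full_chains n -> is_chain C.
Proof. by rewrite full_chainE => /andP[]. Qed.

Lemma min_block_exists n (F C : {set {set 'I_n}}) :
  C \in full_chains n -> F :&: C != set0 -> exists2 A, A \in F & C \in min_block F A.
Proof.
move=> fC /set0Pn[A0 A0FC].
case: (@arg_minnP _ A0 [in F :&: C] (fun A => #|A|) A0FC) => A /setIP[AF AC] mA.
exists A => //; apply/min_blockP; split=> // B BF BC.
have /is_chainP/(_ A B AC BC)/orP[//|sBA] := full_chain_is_chain fC.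
suff /eqP-> : B == A by exact: subxx.
by rewrite eqEcard sBA; apply: mA; rewrite inE BF.
Qed.

Lemma min_block_inj n (F C : {set {set 'I_n}}) A B :
  C \in min_block F A -> C \in min_block F B -> A = B.
Proof.
move=> /min_blockP[_ AF AC mA] /min_blockP[_ BF BC mB].
by apply/eqP; rewrite eqEsubset mA ?mB.
Qed.

(** A full chain meeting F has exactly one least member of F, so the blocks partition these
    chains. *)
Lemma sum_min_block (R : realType) n (F : {set {set 'I_n}}) (g : {set {set 'I_n}} -> R) :
  (\sum_(A in F) \sum_(C in min_block F A) g C =
   \sum_(C in full_chains n | F :&: C != set0) g C)%R.
Proof.
rewrite (exchange_big_dep (fun C => (C \in full_chains n) && (F :&: C != set0))) /=.
  apply: eq_bigr => C /andP[fC FC0].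
  have [A AF bA] := min_block_exists fC FC0.
  rewrite (bigD1 A) ?AF //= big1 ?addr0 // => B /andP[/andP[_ bB] /eqP[]].
  exact: min_block_inj bB bA.
move=> A C AF /min_blockP[-> _ AC _]; apply/set0Pn; exists A; exact/setIP.
Qed.

(** * Permutations fixing A, and chains of a block through a given set *)

Section Swap.
Variables (n : nat) (F : {set {set 'I_n}}) (A : {set 'I_n}).

Definition perm_family (s : {perm 'I_n}) (C : {set {set 'I_n}}) := (fun D : {set 'I_n} => s @: D) @: C.

Lemma perm_family_inj s : injective (perm_family s).
Proof. by apply: imset_inj; apply: imset_inj; exact: perm_inj. Qed.

Lemma perm_family_full s C : C \in full_chains n -> perm_family s C \in full_chains n.
Proof.
rewrite !full_chainE => /andP[/is_chainP cC eC].
rewrite card_imset ?eC ?andbT; last by apply: imset_inj; exact: perm_inj.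
apply/is_chainP => _ _ /imsetP[D DC ->] /imsetP[E EC ->].
by have /orP[/(imsetS s)->|/(imsetS s)->] := cC D E DC EC; rewrite ?orbT.
Qed.

Lemma imset_fix (s : {perm 'I_n}) (D : {set 'I_n}) :
  {in D, forall i, s i = i} -> s @: D = D.
Proof. by move=> sD; rewrite (eq_in_imset (g := id)) ?imset_id. Qed.

(** F need not be invariant under s. If s B is in F with B in C, then either A is below B, hence A =
    s A is below s B, or B is below A, and then s B = B was already a member of F on C. *)
Lemma perm_family_min_block (s : {perm 'I_n}) C :
  {in A, forall i, s i = i} -> C \in min_block F A -> perm_family s C \in min_block F A.
Proof.
move=> sA /min_blockP[fC AF AC mA]; have sAA := imset_fix sA.
apply/min_blockP; split; rewrite ?perm_family_full //.
  by rewrite -sAA; apply: imset_f.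
move=> B' + /imsetP[B BC eB]; rewrite {}eB => BF.
have /is_chainP/(_ A B AC BC)/orP[sAB|sBA] := full_chain_is_chain fC.
  by rewrite -{1}sAA imsetS.
have sBB : s @: B = B by apply: imset_fix => i iB; apply/sA/(subsetP sBA).
by move: BF; rewrite sBB => BF; exact: mA.
Qed.

Definition block_through B := [set C in min_block F A | B \in C].

Lemma leq_block_through (s : {perm 'I_n}) B :
  {in A, forall i, s i = i} -> #|block_through B| <= #|block_through (s @: B)|.
Proof.
move=> sA; rewrite -(card_imset _ (@perm_family_inj s)); apply/subset_leq_card/subsetP.
move=> _ /imsetP[C /setIdP[bC BC] ->]; rewrite in_set perm_family_min_block //.
exact: imset_f.
Qed.

(* Moving one element of B across the boundary of B gives, together with B,   *)
(* n - #|A| sets of the same size containing A, no two on a common chain.     *)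
Lemma card_block_through (B : {set 'I_n}) :
  A \proper B -> B != setT -> (n - #|A|) * #|block_through B| <= #|min_block F A|.
Proof.
move=> /properP[sAB [x xB xA]] /eqP BT.
have [y yB] : exists y, y \notin B.
  apply/existsP; rewrite -negb_forall; apply/negP => /forallP Bt.
  by case: BT; apply/setP => i; rewrite !inE Bt.
have yA : y \notin A by apply: contra yB; exact: (subsetP sAB).
(* The images are B itself (z = x), B with z replaced by y (other z in B), and B with x replaced by
   z (z outside B). Membership of x separates the last kind from the others. *)
pose s z : {perm 'I_n} := if z == x then 1%g else if z \in B then tperm z y else tperm z x.
have sE z : z \notin A -> {in A, forall i, s z i = i}.
  move=> zA i iA; have ni w : w \notin A -> w != i by apply: contraNneq => ->.
  rewrite /s; case: ifP => _; first by rewrite perm1.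
  by case: ifP => _; rewrite tpermD ?ni.
have cE z : #|s z @: B| = #|B| by rewrite card_imset //; exact: perm_inj.
have imE z i : (i \in s z @: B) = ((s z)^-1%g i \in B).
  by rewrite -{1}(permKV (s z) i) mem_imset //; exact: perm_inj.
have xim z : z \notin B -> (x \in s z @: B) = false.
  move=> zB; rewrite imE /s; case: eqP => [ezx|_]; first by rewrite ezx xB in zB.
  by rewrite (negPf zB) tpermV tpermR (negPf zB).
have zim z : z \notin B -> z \in s z @: B.
  move=> zB; rewrite imE /s; case: eqP => [ezx|_]; first by rewrite ezx xB in zB.
  by rewrite (negPf zB) tpermV tpermL.
have xim' z : z \in B -> z != x -> (x \in s z @: B).
  move=> zB zx; rewrite imE /s (negPf zx) zB tpermV tpermD //.
  by apply: contraNneq yB => ->.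
have zim' z : z \in B -> z != x -> (z \in s z @: B) = false.
  by move=> zB zx; rewrite imE /s (negPf zx) zB tpermV tpermL (negPf yB).
have wim w z : z \in B -> z != x -> w != z -> w \in B -> w \in s z @: B.
  move=> zB zx wz wB; rewrite imE /s (negPf zx) zB tpermV tpermD //; first by rewrite eq_sym.
  by apply: contraNneq yB => ->.
have wim' w z : z \notin B -> w != z -> w \notin B -> w \notin s z @: B.
  move=> zB wz wB; rewrite imE /s; case: eqP => [ezx|_]; first by rewrite ezx xB in zB.
  rewrite (negPf zB) tpermV tpermD //; first by rewrite eq_sym.
  by apply: contraNneq wB => <-.
have sx : s x @: B = B by rewrite /s eqxx imset_fix // => i _; rewrite perm1.
have inj z w : s z @: B = s w @: B -> z = w.
  move=> /setP e; apply/eqP; apply: contraT => zw.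
  case: (boolP (z \in B)) (boolP (w \in B)) => [zB|zB] [wB|wB].
  - case: (eqVneq z x) => [ezx|zx].
      have wx : w != x by rewrite -ezx eq_sym.
      by have := e w; rewrite ezx sx zim' ?wB.
    case: (eqVneq w x) => [ewx|wx].
      by have := e z; rewrite ewx sx zim' ?zB.
    by have := e z; rewrite zim' // wim.
  - case: (eqVneq z x) => [ezx|zx].
      by have := e x; rewrite (xim w wB) ezx sx xB.
    by have := e x; rewrite (xim w wB) xim'.
  - case: (eqVneq w x) => [ewx|wx].
      by have := e x; rewrite (xim z zB) ewx sx xB.
    by have := e x; rewrite (xim z zB) xim'.
  - by have := e z; rewrite zim // (negPf (wim' _ _ wB zw zB)).
have -> : n - #|A| = #|~: A| by rewrite [RHS]cardsCs setCK card_ord.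
rewrite -sum_nat_const.
(* Double counting: each image lies on at least as many chains of the block as B, and a chain holds
   at most one image because all images have the same size. *)
apply: (@leq_trans (\sum_(z in ~: A) #|block_through (s z @: B)|)).
  by apply: leq_sum => z; rewrite inE => zA; apply/leq_block_through/sE.
apply: (@leq_trans (\sum_(C in min_block F A) \sum_(z in ~: A) (s z @: B \in C : nat))).
  rewrite exchange_big /=; apply: leq_sum => z _; rewrite -sum1_card big_mkcond.
  rewrite [leqRHS]big_mkcond /=; apply: leq_sum => C _; rewrite in_set.
  by case: (C \in _).
rewrite -sum1_card; apply: leq_sum => C /min_blockP[/full_chain_is_chain cC _ _ _].
have [z0 z0C|none] := pickP (fun z => s z @: B \in C); last by rewrite big1 // => z _; rewrite none.
apply: (@leq_trans (\sum_(z in ~: A) (z == z0 : nat))).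
  apply: leq_sum => z _; case zC: (_ \in C) => //=; rewrite lt0b.
  by apply/eqP/inj/(chain_card_inj cC zC z0C); rewrite /= !cE.
rewrite (eq_bigr (fun z => if z == z0 then 1 else 0)) => [|z _]; last by case: eqP.
rewrite -big_mkcondr sum1_card -(card1 z0); apply/subset_leq_card/subsetP => z.
by rewrite !inE => /andP[_].
Qed.

End Swap.

(** * Mass of a family on a set of chains, and greedy extraction *)

Section Mass.
Variables (R : realType) (n : nat).
Implicit Types (W : {set {set {set 'I_n}}}) (F G C : {set {set 'I_n}}).
Implicit Types (A B : {set 'I_n}) (u : seq {set 'I_n}).
Local Open Scope ring_scope.

(** Kept as a sum rather than an average, since a block may be empty. *)
Definition mass W G : R := \sum_(C in W) #|G :&: C|%:R.

Lemma massU W G1 G2 : [disjoint G1 & G2] -> mass W (G1 :|: G2) = mass W G1 + mass W G2.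
Proof.
move=> dG; rewrite -big_split; apply: eq_bigr => C _ /=.
rewrite setIUl cardsU -natrD.
suff /eqP-> : G1 :&: C :&: (G2 :&: C) == set0 by rewrite cards0 subn0.
apply/eqP/setP => A; rewrite !inE; apply/negP => /andP[/andP[A1 _] /andP[A2 _]].
by move/pred0P/(_ A): dG; rewrite /= A1 A2.
Qed.

Lemma mass_set1 W B : mass W [set B] = #|[set C in W | B \in C]|%:R.
Proof.
rewrite /mass -sum1_card natr_sum big_mkcond [RHS]big_mkcond; apply: eq_bigr => C _.
rewrite [C \in [set _ in _ | _]]in_set; case: (C \in W) => //=.
case: ifP => BC; first by rewrite (setIidPl _) ?cards1 ?sub1set.
by rewrite (_ : _ :&: _ = set0) ?cards0 //; apply/eqP; rewrite setI_eq0 disjoints1 BC.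
Qed.

Lemma mass_le_card W B : mass W [set B] <= #|W|%:R.
Proof.
by rewrite mass_set1 ler_nat subset_leq_card //; apply/subsetP => C /setIdP[].
Qed.

Lemma mass_seq_le W u (b : R) :
  (forall B, B \in u -> mass W [set B] <= b) ->
  mass W [set B in u] <= b *+ size u.
Proof.
move=> ub; apply: (@le_trans _ _ (\sum_(B <- u) mass W [set B])); last first.
  rewrite -[size u]count_predT -iter_addr_0 -big_const_seq.
  by rewrite big_seq [leRHS]big_seq ler_sum.
rewrite /mass exchange_big /=; apply: ler_sum => C _; rewrite -natr_sum ler_nat.
elim: u {ub} => [|B u IH].
  by rewrite big_nil leqn0 cards_eq0; apply/eqP/setP => B; rewrite !inE.
rewrite big_cons set_cons setIUl (leq_trans (leq_card_setU _ _)) //.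
by rewrite leq_add2l.
Qed.

Lemma lubell_le_min_block F (c : R) : 0 <= c ->
  (forall A, A \in F -> mass (min_block F A) F <= c * #|min_block F A|%:R) ->
  lubell R F <= c.
Proof.
move=> c0 Fc; rewrite /lubell ler_pdivrMr; last first.
  by rewrite ltr0n card_full_chains_gt0.
rewrite (bigID (fun C => F :&: C != set0)) /= [X in _ + X]big1 ?addr0; last first.
  by move=> C /andP[_ /negPn/eqP->]; rewrite cards0.
rewrite -sum_min_block (le_trans (ler_sum _ Fc)) // -mulr_sumr ler_wpM2l //.
under eq_bigr => A _ do rewrite -sum1_card natr_sum.
rewrite sum_min_block -natr_sum ler_nat -sum1_card [leqRHS](bigID (fun C => F :&: C != set0)) /=.
exact: leq_addr.
Qed.

Definition upper F A := [set B in F | A \proper B].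

Lemma mass_min_block F A :
  mass (min_block F A) F = #|min_block F A|%:R + mass (min_block F A) (upper F A).
Proof.
rewrite -sum1_card natr_sum -big_split; apply: eq_bigr => C /min_blockP[_ AF AC mA] /=.
rewrite -natrD; congr _%:R; rewrite (cardsD1 A) !inE AF AC; congr (_ + _)%N.
apply: eq_card => B; rewrite !inE andbA andbAC [in RHS]andbAC.
case BF: (B \in F); last by rewrite !andbF.
case BC: (B \in C); last by rewrite !andbF.
by rewrite properEneq mA ?andbT // eq_sym.
Qed.

Definition subset_chain u := uniq u && path.sorted (fun X Y : {set 'I_n} => X \subset Y) u.

Lemma is_chain_sort C : is_chain C -> 
  exists u, [/\ subset_chain u, u =i C & size u = #|C|].
Proof.
move=> /is_chainP cC; pose u := path.sort (fun X Y : {set 'I_n} => X \subset Y) (enum C).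
have uC : u =i C by move=> X; rewrite mem_sort mem_enum.
exists u; split=> //; last by rewrite size_sort -cardE.
rewrite /subset_chain sort_uniq enum_uniq /=.
apply: (@sort_sorted_in _ (mem C)); first by move=> X Y; exact: cC.
by apply/allP => X; rewrite mem_enum.
Qed.

Lemma subset_chain_take u k : subset_chain u -> subset_chain (take k u).
Proof. by case/andP=> uu su; rewrite /subset_chain take_uniq // take_sorted. Qed.

(** Pigeonhole: if every chain of W had at most a - 1 members of G, the mass could not exceed (a -
    1) * |W|. The chain found is truncated to exactly a members. *)
Lemma heavy_chain W G (a : nat) : {in W, forall C, is_chain C} ->
  (a%:R - 1) * #|W|%:R < mass W G ->
  exists u, [/\ subset_chain u, {subset u <= G} & size u = a].
Proof.
move=> cW aW.
have [C CW aC] : exists2 C, C \in W & (a <= #|G :&: C|)%N.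
  apply/exists_inP; apply: contraLR aW; rewrite negb_exists_in => /forall_inP Wa.
  rewrite -leNgt -sum1_card natr_sum mulr_sumr ler_sum // => C /Wa.
  by rewrite -ltnNge mulr1 lerBrDr natr1 ler_nat.
have cGC : is_chain (G :&: C).
  by apply/is_chainP => A B /setIP[_ AC] /setIP[_ BC]; exact: (is_chainP _ (cW _ CW)).
have [u [cu uGC su]] := is_chain_sort cGC.
exists (take a u); split; first exact: subset_chain_take.
  by move=> B /mem_take; rewrite uGC => /setIP[].
by rewrite size_takel // su.
Qed.

Definition disjoint_chains G (s : seq nat) (t : nat -> seq {set 'I_n}) :=
  (forall i, (i < size s)%N ->
     [/\ subset_chain (t i), {subset t i <= G} & size (t i) = nth 0%N s i]) /\
  (forall i j B, (i < size s)%N -> (j < size s)%N -> B \in t i -> B \in t j -> i = j).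

(* A chain of a members exists as long as the average exceeds a - 1; removing *)
(* it costs at most delta.                                                    *)
Lemma greedy_chains W (delta : R) (s : seq nat) G : {in W, forall C, is_chain C} ->
  (forall u, subset_chain u -> {subset u <= G} -> size u \in s ->
    mass W [set B in u] <= delta) ->
  (forall i, (i < size s)%N ->
    ((nth 0%N s i)%:R - 1) * #|W|%:R + delta *+ i < mass W G) ->
  exists t, disjoint_chains G s t.
Proof.
move=> cW; elim: s G => [|a s IH] G Gd Gs; first by exists (fun=> [::]); split.
have [|u [cu uG su]] := @heavy_chain W G a cW.
  by have := Gs 0%N isT; rewrite mulr0n addr0.
have mG : mass W G = mass W [set B in u] + mass W (G :\: [set B in u]).
  rewrite -massU; last by rewrite -setI_eq0 setIDA setIC -setIDA setDv setI0.
  congr mass; apply/setP => B; rewrite !inE; case: (boolP (B \in u)) => //=.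
  by move/uG.
have ud : mass W [set B in u] <= delta by apply: Gd => //; rewrite su mem_head.
have [|i si|t [tP tD]] := IH (G :\: [set B in u]).
- move=> v cv vG sv; apply: Gd => //; first by move=> B /vG/setDP[].
  by rewrite inE sv orbT.
- have := Gs i.+1 si; rewrite /= mulrSr mG; lra.
exists (fun i => if i is i'.+1 then t i' else u).
split=> [[|i]|[|i] [|j] B] //=.
- by move=> /tP[ct tG st]; split=> // B /tG/setDP[].
- by move=> _ /tP[_ tG _] Bu /tG; rewrite !inE Bu.
- by move=> /tP[_ tG _] _ /tG; rewrite !inE => /andP[/negPf->].
- by move=> si sj Bi Bj; rewrite (tD i j B).
Qed.

Lemma card_subset_chain G u l h : subset_chain u -> {subset u <= G} ->
  (forall B, B \in G -> l < #|B| < h)%N -> (size u <= h - l.+1)%N.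
Proof.
move=> /andP[uu su] uG Glh; rewrite -(size_map (fun B => #|B|)).
rewrite -(size_iota l.+1 (h - l.+1)); apply: uniq_leq_size.
  rewrite map_inj_in_uniq // => A B Au Bu.
  apply: (@chain_card_inj _ [set B in u]); rewrite ?inE //.
  apply/is_chainP => X Y; rewrite !inE => Xu Yu.
  have tr : transitive (fun X Y : {set 'I_n} => X \subset Y).
    by move=> ? ? ?; exact: subset_trans.
  have [XY|/ltnW XY] := leqP (index X u) (index Y u).
    by rewrite (sorted_leq_index tr (fun Z => subxx Z) su _ _ Xu Yu XY).
  by rewrite (sorted_leq_index tr (fun Z => subxx Z) su _ _ Yu Xu XY) orbT.
by move=> _ /mapP[B /uG/Glh/andP[lB Bh] ->]; rewrite mem_iota lB; lia.
Qed.

(** Disjointness of the branches suffices: a weak subposet may send incomparable elements to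
    comparable sets. Each branch needs one set less than its chain in the fan, whose minimum is sent
    to A. *)
Lemma fan_contains (l : seq nat) F A t : A \in F ->
  disjoint_chains (upper F A) [seq x.-1 | x <- l] t -> contains (fan l) F.
Proof.
move=> AF [tP tD]; have sz (i : 'I_(size l)) : (i < size [seq x.-1 | x <- l])%N.
  by rewrite size_map.
have szt (i : 'I_(size l)) : size (t i) = (nth 0%N l i).-1.
  by have [_ _ ->] := tP i (sz i); rewrite (nth_map 0%N).
pose f (x : fan l) := if x is Some v then nth A (t (tag v)) (tagged v) else A.
have ft (v : {i : 'I_(size l) & 'I_(nth 0%N l i).-1}) : f (Some v) \in t (tag v).
  by rewrite mem_nth // szt.
have fU v : f (Some v) \in upper F A by have [_ tG _] := tP _ (sz (tag v)); exact: tG (ft v).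
exists f; split.
- move=> [u|] [v|] // e; last 2 first.
  + by have := fU u; rewrite e inE properxx andbF.
  + by have := fU v; rewrite -e inE properxx andbF.
  have fu := ft u; have fv := ft v; rewrite -e in fv.
  have tuv : tag u = tag v by apply/val_inj/(tD _ _ _ (sz _) (sz _) fu fv).
  case: u v tuv e {fu fv} => i a [j b] /= eij; subst j => /eqP e.
  have [/andP[ut _] _ _] := tP i (sz i); congr (Some (existT _ i _)); apply/val_inj/eqP.
  by move: e; rewrite nth_uniq // szt.
- by case=> [v|]; [have := fU v; rewrite inE => /andP[] | ].
- move=> [[i a]|] [[j b]|]; rewrite /Order.le //=; last first.
    by have := fU (Tagged _ b); rewrite inE => /andP[_ /proper_sub].
  case/andP=> /eqP eij; subst j => ab.
  have [/andP[_ st] _ _] := tP i (sz i).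
  have tr : transitive (fun X Y : {set 'I_n} => X \subset Y).
    by move=> ? ? ?; exact: subset_trans.
  by apply: (sorted_leq_nth tr (fun Z => subxx Z) A st) => //; rewrite inE szt.
Qed.

End Mass.

(** * Embeddings of the fan and the value of e *)

Definition fan_elt (l : seq nat) (i : 'I_(size l)) j (h : j < (nth 0 l i).-1) : fan l :=
  Some (Tagged (fun i : 'I_(size l) => 'I_(nth 0 l i).-1) (Ordinal h)).

Section FanEmbedding.
Variables (l : seq nat) (n : nat) (f : fan l -> {set 'I_n}).
Hypotheses (f_inj : injective f) (f_mono : forall x y, (x <= y)%O -> f x \subset f y).

Let ltf x y : (x <= y)%O -> x <> y -> #|f x| < #|f y|.
Proof.
move=> xy nxy; rewrite proper_card // properEneq f_mono // andbT.
by apply/eqP => /f_inj.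
Qed.

Lemma card_fan_bot (i : 'I_(size l)) j (h : j < (nth 0 l i).-1) : #|f None| < #|f (fan_elt h)|.
Proof. exact: ltf. Qed.

Lemma card_fan_elt (i : 'I_(size l)) j j' (h : j < (nth 0 l i).-1) (h' : j' < (nth 0 l i).-1) :
  j <= j' -> #|f (fan_elt h)| + (j' - j) <= #|f (fan_elt h')|.
Proof.
elim: j' h' => [|k IH] h' jk.
  have ej : j = 0 by lia.
  by subst j; rewrite subnn addn0 (bool_irrelevance h h').
move: jk; rewrite leq_eqVlt => /orP[/eqP ej|jk].
  by subst j; rewrite subnn addn0 (bool_irrelevance h h').
have hk : k < (nth 0 l i).-1 by lia.
have : #|f (fan_elt hk)| < #|f (fan_elt h')|.
  apply: ltf; first by rewrite /Order.le /= eqxx leqnSn.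
  by move/(congr1 (fun x : fan l => if x is Some v then nat_of_ord (tagged v) else 0)) => /=; lia.
by have := IH hk jk; lia.
Qed.

End FanEmbedding.

Lemma mem_levels n (s : int) k (A : {set 'I_n}) :
  (A \in levels n s k) = (s <= Posz #|A| < s + Posz k)%R.
Proof.
apply/bigcupP/idP => [[i _]|sA]; first by rewrite inE => /eqP ->; have := ltn_ord i; lia.
have ik : absz (Posz #|A| - s)%R < k by lia.
exists (Ordinal ik) => //; rewrite inE /= gez0_abs; first by rewrite addrC subrK.
by rewrite subr_ge0; case/andP: sA.
Qed.

Lemma card_fan_gt0 l : 0 < #|{: fan l}|.
Proof. by apply/card_gt0P; exists None. Qed.

Lemma nth_sorted_geq l i : sorted geq l -> nth 0 l i <= nth 0 l 0.
Proof.
move=> sl; have [il|li] := ltnP i (size l); last by rewrite nth_default.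
have tr : transitive geq by move=> ? ? ? /[swap]; exact: leq_trans.
by apply: (sorted_leq_nth tr leqnn 0 sl) => //; rewrite inE // (leq_ltn_trans _ il).
Qed.

(** The elements below x form a chain, so their ranks [rk] are distinct, and ranks are below l_0. *)
Lemma card_fan_downset l (x : fan l) : sorted geq l -> 0 < nth 0 l 0 ->
  #|[set i : 'I_#|{: fan l}| | (enum_val i <= x)%O]| <= nth 0 l 0.
Proof.
move=> sl l0; pose rk (y : fan l) := if y is Some v then (tagged v).+1 else 0.
have rk_lt (y : fan l) : rk y < nth 0 l 0.
  case: y => [[i a]|//] /=; have := ltn_ord a; have := nth_sorted_geq i sl; lia.
pose g (i : 'I_#|{: fan l}|) := Ordinal (rk_lt (enum_val i)).
rewrite -[leqRHS]card_ord -(@card_in_imset _ _ g); first exact: max_card.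
move=> i j; rewrite !inE => ix jx [e]; apply: enum_val_inj.
move: (enum_val i) (enum_val j) ix jx e => [[a1 b1]|] [[a2 b2]|] //=.
case: x => [[a b]|] //; rewrite /Order.le /= => /andP[/eqP e1 _] /andP[/eqP e2 _].
subst a1 a2 => -[e]; congr (Some (existT _ a _)); exact: val_inj.
Qed.

(** Levels fewer than l_0 in number cannot hold the longest chain. Conversely, principal down-sets
    embed the fan into its own power set with sizes from 1 to l_0, so l_0 levels can contain it. *)
Lemma poset_e_fan l : 0 < size l -> sorted geq l -> 1 < nth 0 l 0 ->
  poset_e (fan l) = (nth 0 l 0).-1.
Proof.
move=> sl gl l0; have [eF emax] := poset_eP (card_fan_gt0 l).
apply/eqP; rewrite eqn_leq; apply/andP; split; last first.
  apply: emax => n s [f [fi fF fm]].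
  have h0 : 0 < (nth 0 l (Ordinal sl)).-1 by rewrite /=; lia.
  have hl : (nth 0 l 0).-2 < (nth 0 l (Ordinal sl)).-1 by rewrite /=; lia.
  have := card_fan_bot fi fm h0; have := card_fan_elt fi fm h0 hl (leq0n _).
  have := fF None; have := fF (fan_elt hl); rewrite !mem_levels; lia.
rewrite leqNgt; apply/negP => le; apply: (eF #|{: fan l}| 1%R).
exists (fun x => [set i | (enum_val i <= x)%O]); split.
- move=> x y /setP exy; apply/le_anti/andP; split.
    by have := exy (enum_rank x); rewrite !inE enum_rankK lexx => <-.
  by have := exy (enum_rank y); rewrite !inE enum_rankK lexx => ->.
- move=> x; rewrite mem_levels; apply/andP; split.
    by apply/card_gt0P; exists (enum_rank x); rewrite inE enum_rankK.
  apply: (@leq_ltn_trans (nth 0 l 0)); first exact: card_fan_downset x gl (ltnW l0).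
  by move: le; rewrite prednK // ltnW.
- move=> x y lexy; apply/subsetP => i; rewrite !inE => /le_trans; exact.
Qed.

(** * Upper bounds for fan-free families *)

Lemma nth_sorted_gtn l i : sorted gtn l -> i < size l -> nth 0 l i + i <= nth 0 l 0.
Proof.
move=> /(sortedP 0) sl; elim: i => [|i IH] il; first by rewrite addn0.
by have := IH (ltnW il); have := sl i il; rewrite /=; lia.
Qed.

Section Bounds.
Variables (R : realType) (n : nat) (F : {set {set 'I_n}}).
Local Open Scope ring_scope.
Local Notation w A := (#|min_block F A|%:R : R).

Lemma min_block_is_chain A : {in min_block F A, forall C, is_chain C}.
Proof. by move=> C /min_blockP[/full_chain_is_chain]. Qed.

Lemma mass_upper_set1 A (B : {set 'I_n}) : B \in upper F A -> (#|B| < n)%N ->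
  mass R (min_block F A) [set B] <= w A / (n - #|A|)%:R.
Proof.
rewrite inE => /andP[_ pAB] Bn; have lAB := proper_card pAB.
rewrite ler_pdivlMr; last by rewrite ltr0n subn_gt0; lia.
rewrite mass_set1 -natrM ler_nat mulnC; apply: card_block_through => //.
by apply: contraTneq Bn => ->; rewrite cardsT card_ord ltnn.
Qed.

Lemma mass_chain_le A (G : {set {set 'I_n}}) u : G \subset upper F A -> (forall B, B \in G -> #|B| < n)%N ->
  subset_chain u -> {subset u <= G} ->
  mass R (min_block F A) [set B in u] <= (size u)%:R * (w A / (n - #|A|)%:R).
Proof.
move=> GU Gn cu uG; rewrite mulr_natl; apply: mass_seq_le => B /uG BG.
by apply: mass_upper_set1; [exact: (subsetP GU) | exact: Gn].
Qed.

(** A chain strictly between A and [n] has at most n - |A| members, each on at most a 1 / (n - |A|)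
    fraction of the block. *)
Lemma mass_chain_le_card A (G : {set {set 'I_n}}) u : G \subset upper F A -> (forall B, B \in G -> #|B| < n)%N ->
  subset_chain u -> {subset u <= G} ->
  mass R (min_block F A) [set B in u] <= w A.
Proof.
move=> GU Gn cu uG; apply: le_trans (mass_chain_le GU Gn cu uG) _.
have su : (size u <= n - #|A|)%N.
  apply: leq_trans (leq_sub2l _ (leqnSn _)).
  apply: (card_subset_chain cu uG) => B BG; rewrite Gn //= andbT.
  by have := subsetP GU _ BG; rewrite inE => /andP[_ /proper_card].
have [e|N0] := posnP (n - #|A|); first by move: su; rewrite e leqn0 => /eqP->; rewrite mul0r.
by rewrite mulrCA ler_piMr // ler_pdivrMr ?ltr0n // mul1r ler_nat.
Qed.

Lemma free_mass_le (l : seq nat) A (delta c : R) : poset_free (fan l) F -> A \in F ->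
  (forall u, subset_chain u -> {subset u <= upper F A} -> size u \in [seq x.-1 | x <- l] ->
    mass R (min_block F A) [set B in u] <= delta) ->
  (forall i, (i < size l)%N ->
    ((nth 0%N l i).-1%:R - 1) * w A + delta *+ i <= (c - 1) * w A) ->
  mass R (min_block F A) F <= c * w A.
Proof.
move=> free AF ud lc; rewrite leNgt; apply/negP => lt; apply: free.
have [|t tP] := greedy_chains (@min_block_is_chain A) ud; last exact: fan_contains AF tP.
move=> i; rewrite size_map => il; rewrite (nth_map 0%N) //.
by apply: le_lt_trans (lc i il) _; move: lt; rewrite mass_min_block; lra.
Qed.

(** With removal cost w, branch i requires l_i - 2 + i <= l_0 - 2, which is what strict decrease
    gives. *)
Lemma strict_mass_le (l : seq nat) A : all (leq 2) l -> sorted gtn l ->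
  poset_free (fan l) F -> A \in F -> (forall B, B \in upper F A -> #|B| < n)%N ->
  mass R (min_block F A) F <= (nth 0%N l 0).-1%:R * w A.
Proof.
move=> l2 sl free AF Fn; apply: (free_mass_le (delta := w A) free AF) => [u cu uU _|i il].
  exact: mass_chain_le_card (subxx _) Fn cu uU.
rewrite -[w A *+ i]mulr_natl -mulrDl ler_wpM2r //.
have := nth_sorted_gtn sl il; have /allP/(_ _ (mem_nth 0%N il)) := l2.
move=> /= li2 lii; rewrite addrAC lerD2r -natrD ler_nat; lia.
Qed.

(* A chain of size l_0 - 2 below the top element extends by the latter.       *)
Lemma strict_top_mass_le (l : seq nat) A : all (leq 2) l -> (0 < size l)%N ->
  sorted gtn ((nth 0%N l 0).-1 :: behead l) ->
  poset_free (fan l) F -> A \in F -> setT \in upper F A ->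
  mass R (min_block F A) F <= (nth 0%N l 0).-1%:R * w A.
Proof.
case: l => [//|l0 l] l2 _ /= sl free AF TU; rewrite leNgt; apply/negP => lt.
have l02 : (2 <= l0)%N by case/andP: l2.
pose G := upper F A :\ setT.
have GU : G \subset upper F A by apply: subsetDl.
have Gn B : B \in G -> (#|B| < n)%N.
  case/setD1P => BT _; rewrite -[X in (_ < X)%N]card_ord -cardsT proper_card //.
  by rewrite properT.
(* The mass above A exceeds (l_0 - 2) * w, and [n] takes at most w of it. *)
have mG : (l0%:R - 3) * w A < mass R (min_block F A) G.
  have : mass R (min_block F A) (upper F A) <= w A + mass R (min_block F A) G.
    rewrite -(setD1K TU) massU ?lerD2r ?mass_le_card //.
    by rewrite disjoints1 !inE eqxx.
  move: lt; rewrite mass_min_block -subn1 natrB ?(ltnW l02) //; lra.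
have [||t [tP tD]] := @greedy_chains R n _ (w A) (l0.-2 :: [seq x.-1 | x <- l]) G (@min_block_is_chain A).
- by move=> u cu uG _; exact: mass_chain_le_card GU Gn cu uG.
- move=> i il; apply: le_lt_trans mG.
  rewrite -[w A *+ i]mulr_natl -mulrDl ler_wpM2r //.
  have il' : (i < size (l0.-1 :: l))%N by move: il; rewrite /= size_map.
  have := @nth_sorted_gtn (l0.-1 :: l) i sl il'; rewrite /=.
  case: i il {il'} => [_ _|i il] /=.
    by rewrite -subn2 natrB //; lra.
  have {}il : (i < size l)%N by move: il; rewrite /= size_map.
  rewrite (nth_map 0%N) //.
  case/andP: l2 => _ /allP/(_ _ (mem_nth 0%N il)) /= li2 lii.
  have : ((nth 0%N l i).-1 + i.+1 + 2 <= l0)%N by lia.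
  by rewrite -(ler_nat R) !natrD; lra.
(* Since [G] omits [n], the top can be appended to the first branch, restoring its length l_0 - 1
   while keeping the branches disjoint. *)
apply: free; pose t' i := if i is i'.+1 then t i else rcons (t 0%N) setT.
apply: (fan_contains (t := t') AF); split=> [i il|i j B il jl].
  have [/andP[ut st] tG ts] := tP i il.
  case: i il ut st tG ts => [_|i il] ut st tG ts.
    split; last by rewrite /= size_rcons ts /=; lia.
      rewrite /subset_chain rcons_uniq ut andbT; apply/andP; split.
        by apply/negP => /tG; rewrite !inE eqxx.
      rewrite /= -cats1; case: (t 0%N) st => [//|B s] /= st.
      by rewrite cat_path st /= subsetT.
    by move=> B; rewrite /= mem_rcons inE => /orP[/eqP->//|/tG/(subsetP GU)].
  by split=> //; [apply/andP | move=> B /tG/(subsetP GU)].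
have T k : (0 < k < size (l0.-2 :: [seq x.-1 | x <- l]))%N -> setT \notin t k.
  by case/andP=> _ kl; have [_ tG _] := tP k kl; apply/negP => /tG; rewrite !inE eqxx.
case: i j il jl => [|i] [|j] il jl //=; last exact: tD.
- rewrite mem_rcons inE => /orP[/eqP->|B0 Bj]; last exact: tD B0 Bj.
  by move=> Bj; case/negP: (T j.+1 jl).
- rewrite mem_rcons inE => Bi /orP[/eqP eB|B0]; last exact: tD Bi B0.
  by case/negP: (T i.+1 il); rewrite -eB.
Qed.

(** A branch has fewer than l_0 members, so i removals cost at most i * l_0 / (n - |A|) of the
    block. *)
Lemma wide_lubell_le (l : seq nat) (c : R) : 0 <= c -> sorted geq l ->
  poset_free (fan l) F ->
  (forall A, A \in F -> #|A| < n)%N ->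
  (forall A i, A \in F -> (i < size l)%N ->
     (nth 0%N l i).-1%:R + (i * nth 0%N l 0)%:R / (n - #|A|)%:R <= c) ->
  lubell R F <= c.
Proof.
move=> c0 sl free Fn Fc; apply: lubell_le_min_block => // A AF.
have N0 : 0 < (n - #|A|)%:R :> R by rewrite ltr0n subn_gt0 Fn.
pose delta := (nth 0%N l 0)%:R * (w A / (n - #|A|)%:R).
apply: (free_mass_le (delta := delta) free AF) => [u cu uU|i il].
  move=> /mapP[x /(nthP 0%N)[i _ <-] su].
  have Un B : B \in upper F A -> (#|B| < n)%N by rewrite inE => /andP[/Fn].
  apply: le_trans (mass_chain_le (subxx _) Un cu uU) _.
  rewrite ler_wpM2r ?divr_ge0 // ler_nat su.
  exact: leq_trans (leq_pred _) (nth_sorted_geq i sl).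
have -> : delta *+ i = (i * nth 0%N l 0)%:R / (n - #|A|)%:R * w A.
  by rewrite -[delta *+ i]mulr_natl /delta natrM mulrA -!mulrA [w A * _]mulrC.
rewrite -mulrDl ler_wpM2r //; have := Fc A i AF il; lra.
Qed.

End Bounds.

(** * Failure of L-boundedness when the two longest chains are equal *)

Section Unbounded.
Variables (n m k : nat) (G0 : {set 'I_n}).

Definition gap_levels : {set {set 'I_n}} :=
  [set A : {set 'I_n} | (m <= #|A| < m + k) && (#|A| != m.+1)].

(** A chain of k sets within k consecutive levels takes one set from each, so its second set is G0.
    Two branches of maximal length would both use G0, against injectivity. *)
Lemma gap_levels_free (l : seq nat) : 1 < size l -> nth 0 l 0 = nth 0 l 1 ->
  k = nth 0 l 0 -> 1 < k -> #|G0| = m.+1 -> poset_free (fan l) (G0 |: gap_levels).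
Proof.
move=> sl e01 ek k1 eG [f [fi fF fm]].
have fG x : m <= #|f x| < m + k /\ (#|f x| = m.+1 -> f x = G0).
  have := fF x; rewrite !inE => /orP[/eqP->|/andP[-> /eqP ?]]; last by split.
  by rewrite eG; split=> //; lia.
have only (i : 'I_(size l)) (h0 : 0 < (nth 0 l i).-1) : nth 0 l i = k -> f (fan_elt h0) = G0.
  move=> eik; have hl : k.-2 < (nth 0 l i).-1 by lia.
  have := card_fan_bot fi fm h0; have := card_fan_elt fi fm h0 hl (leq0n _).
  have [/andP[+ _] _] := fG None; have [/andP[_ +] _] := fG (fan_elt hl).
  by have [_ + ? ? ? ?] := fG (fan_elt h0); apply; lia.
pose i0 := Ordinal (ltnW sl); pose i1 := Ordinal sl.
have h0 : 0 < (nth 0 l i0).-1 by rewrite /=; lia.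
have h1 : 0 < (nth 0 l i1).-1 by rewrite /=; lia.
have : fan_elt h0 = fan_elt h1 by apply: fi; rewrite !only //= -?e01 -?ek.
by move/(congr1 (fun x : fan l => if x is Some v then nat_of_ord (tag v) else 0)).
Qed.

Lemma card_gap_levels_chain C : C \in full_chains n -> m + k <= n.+1 -> 1 < k ->
  k.-1 <= #|gap_levels :&: C|.
Proof.
move=> fC mkn k1; pose r := m :: iota m.+2 k.-2.
have -> : k.-1 = size r by rewrite /= size_iota; lia.
rewrite cardE -(size_map (fun A : {set 'I_n} => #|A|)); apply: uniq_leq_size.
  by rewrite /= iota_uniq mem_iota andbT; lia.
move=> j jr; have {jr} [jk jm] : m <= j < m + k /\ j != m.+1.
  by move: jr; rewrite inE mem_iota; lia.
have [|A AC eA] := @full_chain_level n C j fC; first by lia.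
by apply/mapP; exists A => //; rewrite mem_enum !inE eA jk jm.
Qed.

Local Open Scope ring_scope.

(** Every full chain meets the k - 1 complete levels, and G0 adds a positive term. *)
Lemma lubell_gap_levels (R : realType) : (m + k <= n.+1)%N -> (1 < k)%N -> #|G0| = m.+1 ->
  k.-1%:R < lubell R (G0 |: gap_levels).
Proof.
move=> mkn k1 eG; have G0' : G0 \notin gap_levels by rewrite inE eG eqxx andbF.
rewrite lubellE big_setU1 //= -lubellE.
have low : k.-1%:R <= lubell R gap_levels.
  rewrite /lubell ler_pdivlMr ?ltr0n ?card_full_chains_gt0 // mulrC.
  rewrite -sum1_card natr_sum mulr_suml; apply: ler_sum => C fC.
  by rewrite mul1r ler_nat card_gap_levels_chain.
apply: le_lt_trans low _; rewrite ltrDr invr_gt0 ltr0n bin_gt0.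
by rewrite -[leqRHS]card_ord max_card.
Qed.

End Unbounded.

Lemma not_L_bounded_fan (R : realType) (l : seq nat) : 1 < size l -> sorted geq l ->
  1 < nth 0 l 0 -> nth 0 l 0 = nth 0 l 1 -> ~ L_bounded R (fan l).
Proof.
(* With n = 2m + k, the sizes m, ..., m + k - 1 lie in [m, n - m]. *)
move=> sl gl l0 e01 [m bound]; pose k := nth 0 l 0; pose n := m.*2 + k.
have [||G0 [_ _ eG]] := @subset_between n set0 setT m.+1; first exact: sub0set.
  by rewrite cards0 cardsT card_ord /n /k; lia.
have mkn : m + k <= n.+1 by rewrite /n; lia.
have := bound n (G0 |: gap_levels n m k) (@gap_levels_free n m k G0 l sl e01 erefl l0 eG).
rewrite poset_e_fan //; last exact: ltnW.
rewrite leNgt lubell_gap_levels // => /(_ _)/negP[] // A.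
by rewrite !inE => /orP[/eqP->|]; rewrite ?eG /n; move: l0; rewrite -/k; lia.
Qed.

(** * The four boundedness properties *)

Section FanBoundedness.
Variables (R : realType) (l : seq nat).
Local Open Scope ring_scope.

Lemma lower_L_bounded_fan : (0 < size l)%N -> sorted geq l ->
  (1 < nth 0%N l 0)%N -> lower_L_bounded R (fan l).
Proof.
move=> sl gl l0 beta eps /andP[b2 b1] e0; rewrite poset_e_fan //.
(* For n >= M, eps * (n - |A|) >= eps * (1 - beta) * n >= S, and S bounds every i * l_0, so the
   removals cost at most eps. *)
pose S : R := (size l * nth 0%N l 0)%:R; pose M := S / (eps * (1 - beta)).
have b0 : 0 < 1 - beta by rewrite subr_gt0.
have [N MN] : exists N : nat, M <= N%:R.
  by exists (Num.bound M); apply/ltW/archi_boundP; rewrite divr_ge0 ?mulr_ge0 // ltW.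
exists N => n Nn F free Fb.
have Fn A : A \in F -> (#|A| < n)%N.
  move=> /Fb Ab; rewrite -(ltr_nat R); apply: lt_le_trans Ab _.
  by rewrite ler_piMl // ltW.
apply: (wide_lubell_le _ gl free Fn); first by rewrite addr_ge0 // ltW.
move=> A i AF il; apply: lerD.
  by rewrite ler_nat; have := nth_sorted_geq i gl; lia.
have nA : (1 - beta) * n%:R <= (n - #|A|)%:R.
  by rewrite natrB ?(ltnW (Fn A AF)) //; have := Fb A AF; lra.
rewrite ler_pdivrMr ?ltr0n ?subn_gt0 ?Fn //.
apply: le_trans (_ : S <= _); first by rewrite ler_nat leq_mul // ltnW.
apply: le_trans (_ : eps * ((1 - beta) * n%:R) <= _); last by rewrite ler_pM2l.
rewrite mulrA mulrC -ler_pdivrMr ?mulr_gt0 //.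
by apply: le_trans MN _; rewrite ler_nat.
Qed.

Lemma L_bounded_fan : (1 < size l)%N -> sorted geq l ->
  (1 < nth 0%N l 0)%N -> (nth 0%N l 1 < nth 0%N l 0)%N -> L_bounded R (fan l).
Proof.
(* This m makes n - |A| >= i * l_0, so the removals cost at most one unit, which l_i <= l_1 < l_0
   absorbs for i >= 1; the first branch pays nothing. *)
move=> sl gl l0 l10; exists (size l * nth 0%N l 0)%N => n F free Fm.
rewrite poset_e_fan ?(ltnW sl) //.
have Sl : (1 < size l * nth 0%N l 0)%N by lia.
have Fn A : A \in F -> (#|A| < n)%N by move=> /Fm; lia.
apply: (wide_lubell_le _ gl free Fn) => // A [|i] AF il; first by rewrite mul0n mul0r addr0.
have li : (nth 0%N l i.+1 <= nth 0%N l 1)%N.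
  case: l sl gl {l0 l10 Sl Fm free} il => [//|a s] /= _ gs; rewrite ltnS => il.
  by apply: nth_sorted_geq; exact: path_sorted gs.
have N0 : (0 < n - #|A|)%N by rewrite subn_gt0 Fn.
have : (i.+1 * nth 0%N l 0)%:R / (n - #|A|)%:R <= 1 :> R.
  rewrite ler_pdivrMr ?ltr0n // mul1r ler_nat.
  apply: (@leq_trans (size l * nth 0%N l 0)); first by rewrite leq_mul // ltnW.
  by have := Fm A AF; lia.
have : ((nth 0%N l i.+1).-1 + 1 <= (nth 0%N l 0).-1)%N by lia.
by rewrite -(ler_nat R) natrD; lra.
Qed.

Lemma centrally_L_bounded_fan : (0 < size l)%N ->
  all (leq 2) l -> sorted gtn l -> sorted geq l -> (1 < nth 0%N l 0)%N ->
  centrally_L_bounded R (fan l).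
Proof.
move=> sl l2 tl gl l0 n F free Fm; rewrite poset_e_fan //.
apply: lubell_le_min_block => // A AF; apply: (strict_mass_le _ l2 tl free AF) => B.
by rewrite inE => /andP[/Fm + _]; lia.
Qed.

Lemma uniformly_L_bounded_fan : (0 < size l)%N ->
  all (leq 2) l -> sorted gtn ((nth 0%N l 0).-1 :: behead l) -> sorted geq l ->
  (1 < nth 0%N l 0)%N -> uniformly_L_bounded R (fan l).
Proof.
move=> sl l2 tl gl l0 n F free Fm; rewrite poset_e_fan //.
apply: lubell_le_min_block => // A AF.
(* [n] lies on every full chain, so the estimate for single sets fails for it and its presence above
   A is treated apart. *)
have [TU|TU] := boolP (setT \in upper F A); first exact: (strict_top_mass_le _ l2 sl tl free AF TU).
apply: (strict_mass_le _ l2 _ free AF).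
  case: l {sl l2 gl l0 free} tl => [//|a [//|b s]] /= /andP[ba ->]; rewrite andbT.
  by lia.
move=> B BU; rewrite -[X in (_ < X)%N]card_ord -cardsT proper_card //.
by rewrite properT; apply: contraNneq TU => <-.
Qed.

End FanBoundedness.

Theorem theorem5p1 (R : realType) (l : seq nat)
    (l_neq0 : 0 < size l) (l_sorted : sorted geq l) (l_ge2 : all (leq 2) l) :
  [/\ size l = 1 \/
        [/\ 1 < size l, nth 0 l 1 < nth 0 l 0 - 1 & sorted gtn (behead l)] ->
        uniformly_L_bounded R (fan l),
      sorted gtn l -> centrally_L_bounded R (fan l),
      1 < size l -> nth 0 l 1 < nth 0 l 0 -> L_bounded R (fan l) &
      1 < size l -> nth 0 l 0 = nth 0 l 1 ->
        ~ L_bounded R (fan l) /\ lower_L_bounded R (fan l)].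
Proof.
have l0 : 1 < nth 0 l 0 by have /allP/(_ _ (mem_nth 0 l_neq0)) := l_ge2.
split=> [lcase|tl|l1 l10|l1 e01].
- apply: uniformly_L_bounded_fan => //; case: lcase => [s1|[s1 l10 tl]].
    by case: l s1 {l_neq0 l_sorted l_ge2 l0} => [|a []].
  case: l s1 l10 tl {l_neq0 l_sorted l_ge2 l0} => [//|a [//|b s]] /= _ ba ->.
  by rewrite andbT; lia.
- exact: centrally_L_bounded_fan.
- exact: L_bounded_fan.
- by split; [exact: not_L_bounded_fan | exact: lower_L_bounded_fan].
Qed.
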